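(* Let $m$ be a positive integer such that a Hadamard matrix of order $m$ exists. Then there exists a balancedly splittable Hadamard matrix of order $m^2$ with parameters $(m^2,m,m,0)$.
   Context: A Hadamard matrix of order $n$ is an $n\times n$ $\{1,-1\}$-matrix $H$ with $HH^\top=nI_n$; $J_n$ is the all-ones matrix. $H$ is balancedly splittable with parameters $(n,\ell,a,b)$ if, after permuting its rows, $H=\begin{pmatrix}H_1\\H_2\end{pmatrix}$ with $H_1$ an $\ell\times n$ matrix such that $H_1^\top H_1=\ell I_n+aA+b(J_n-A-I_n)$ for a symmetric $(0,1)$-matrix $A$ with zero diagonal. *)

(* Defs.v *)
From HB Require Import structures.
From mathcomp Require Import all_boot all_order all_fingroup all_algebra.

Set Implicit Arguments.
Unset Strict Implicit.
Unset Printing Implicit Defensive.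

Import GRing.Theory.

Local Open Scope ring_scope.

Definition hadamard (n : nat) (H : 'M[int]_n) : Prop :=
  (forall i j, H i j = 1 \/ H i j = -1) /\ H *m H^T = (n%:Z)%:M.

(* [k] is the number n - l of rows of the lower block; the cast transports
   the block matrix from (l + k) rows to n rows. *)
Definition balancedly_splittable (n l : nat) (a b : int) (H : 'M[int]_n) :
    Prop :=
  exists (k : nat) (eq_lk : (l + k)%N = n) (s : 'S_n)
         (H1 : 'M[int]_(l, n)) (H2 : 'M[int]_(k, n)),
    row_perm s H = castmx (eq_lk, erefl n) (col_mx H1 H2) /\
    exists A : 'M[int]_n,
      [/\ A^T = A,
          forall i j, A i j = 0 \/ A i j = 1,
          forall i, A i i = 0
        & H1^T *m H1 =
            (l%:Z)%:M + a *: A + b *: (const_mx 1 - A - 1%:M)].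

(* Main.v *)
Require Import Defs.
From HB Require Import structures.
From mathcomp Require Import all_boot all_order all_fingroup all_algebra.
From mathcomp Require Import mxtens.

Set Implicit Arguments.
Unset Strict Implicit.
Unset Printing Implicit Defensive.

Import GRing.Theory.

Local Open Scope ring_scope.

(** Let [N] be [H] with its columns negated so that row [0] is all ones.  The
    first [m] rows of the Kronecker product of [N] and [H] form the matrix
    [H1 = (H ... H)], so [H1^T H1] is the Kronecker product of [J] and
    [H^T H = m I]: off the diagonal its entries are [m] and [0]. *)

Lemma tensmx_scalar (R : comPzRingType) (m n : nat) (a b : R) :
  (a%:M : 'M_m) *t (b%:M : 'M_n) = (a * b)%:M.
Proof.
apply/matrixP=> p q.
case: (mxtens_indexP p) => i j; case: (mxtens_indexP q) => k l.
rewrite tensmxE !mxE (can_eq (@mxtens_indexK m n)) xpair_eqE.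
by case: eqP; case: eqP => *; rewrite ?(mulr0n, mulr1n, mul0r, mulr0).
Qed.

Lemma sign_mulr (x y : int) :
  x = 1 \/ x = -1 -> y = 1 \/ y = -1 -> x * y = 1 \/ x * y = -1.
Proof. by move=> [->|->] [->|->]; rewrite ?mulrNN ?mulr1 ?mul1r; auto. Qed.

Lemma sign_mulrr (x : int) : x = 1 \/ x = -1 -> x * x = 1.
Proof. by move=> [->|->]; rewrite ?mulrNN mulr1. Qed.

(** By the mixed-product rule, the Gram matrix of [G *t H] is the Kronecker product of the two Gram
    matrices. *)
Lemma hadamard_tens (m n : nat) (G : 'M[int]_m) (H : 'M[int]_n) :
  hadamard G -> hadamard H -> hadamard (G *t H).
Proof.
move=> [G1 GG] [H1 HH]; split.
  by move=> p q; rewrite mxE; apply: sign_mulr.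
by rewrite trmx_tens tensmx_mul GG HH tensmx_scalar PoszM.
Qed.

Definition normalize_cols (m : nat) (i0 : 'I_m) (H : 'M[int]_m) : 'M[int]_m :=
  \matrix_(i, j) (H i j * H i0 j).

(** In the inner product of two rows, the term of column [j] gains the factor [H i0 j * H i0 j],
    which is 1. *)
Lemma hadamard_normalize_cols (m : nat) (i0 : 'I_m) (H : 'M[int]_m) :
  hadamard H -> hadamard (normalize_cols i0 H).
Proof.
move=> [H1 HH]; split; first by move=> i j; rewrite mxE; apply: sign_mulr.
rewrite -HH; apply/matrixP=> i k; rewrite !mxE; apply: eq_bigr => j _.
by rewrite !mxE mulrACA (sign_mulrr (H1 _ _)) mulr1.
Qed.

(** Over the integers [H] need not be invertible, so it is cancelled from [H *m (H^T *m H - n) = 0]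
    by means of its adjugate and its nonzero determinant. *)
Lemma hadamard_trmx_mul (n : nat) (H : 'M[int]_n) :
  (0 < n)%N -> hadamard H -> H^T *m H = (n%:Z)%:M.
Proof.
move=> n_gt0 [_ HH]; apply/eqP; rewrite -subr_eq0.
have n_neq0 : n%:Z != 0 by rewrite -lt0n.
have HB : H *m (H^T *m H - (n%:Z)%:M) = 0.
  by rewrite mulmxBr mulmxA HH scalar_mxC subrr.
(* Taking determinants in [HH] gives [\det H * \det H^T = n ^ n]. *)
have detH : \det H != 0.
  apply: contraNneq (expf_neq0 n n_neq0) => detH0.
  by rewrite -det_scalar -HH det_mulmx detH0 mul0r.
have : \det H *: (H^T *m H - (n%:Z)%:M) = 0.
  by rewrite -mul_scalar_mx -mul_adj_mx -mulmxA HB mulmx0.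
by move/eqP; rewrite scalemx_eq0 (negPf detH).
Qed.

Theorem theorem3p2 (m : nat) (m_gt0 : (0 < m)%N)
    (exH : exists H : 'M[int]_m, hadamard H) :
  exists K : 'M[int]_(m ^ 2)%N,
    hadamard K /\ balancedly_splittable m (m%:Z) 0 K.
Proof.
have [H hadH] := exH; pose i0 := Ordinal m_gt0.
pose K : 'M[int]_(m ^ 2)%N := normalize_cols i0 H *t H.
exists K; split.
  exact: (hadamard_tens (hadamard_normalize_cols i0 hadH) hadH).
have eq_lk : (m + (m ^ 2 - m) = m ^ 2)%N.
  by rewrite subnKC // -[leqLHS]muln1 leq_mul2l m_gt0 orbT.
(* The cast only splits the row index for [usubmx]; the first [m] rows are already the wanted block,
   so the permutation is the identity. *)
pose K' := castmx (esym eq_lk, erefl _) K.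
exists (m ^ 2 - m)%N, eq_lk, 1%g, (usubmx K'), (dsubmx K'); split.
  by rewrite row_perm1 vsubmxK castmx_comp castmx_id.
have K'E i k l : usubmx K' i (@mxtens_index m m (k, l)) = H i l.
  rewrite mxE castmxE cast_ord_id esymK.
  (* Both indices have value [i], because the pair [(i0, i)] is encoded as [0 * m + i]. *)
  have -> : cast_ord eq_lk (lshift (m ^ 2 - m) i) = @mxtens_index m m (i0, i).
    exact: val_inj.
  rewrite [LHS]tensmxE mxE sign_mulrr ?mul1r //; exact: hadH.1.
pose ui := @mxtens_unindex m m.
(* This is the Kronecker product of [J - I] and [I]: it marks the off-diagonal places where the Gram
   matrix has entry [m]. *)
exists (\matrix_(p, q) (((ui p).1 != (ui q).1) && ((ui p).2 == (ui q).2))%:R).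
split.
- by apply/matrixP=> p q; rewrite !mxE eq_sym [X in _ && X]eq_sym.
- by move=> p q; rewrite mxE; case: (_ && _); auto.
- by move=> p; rewrite mxE eqxx.
apply/matrixP=> p q.
case: (@mxtens_indexP m m p) => i j; case: (@mxtens_indexP m m q) => k l.
(* The block indices [i] and [k] drop out, since [H1] repeats [H]. *)
transitivity ((H^T *m H) j l).
  by rewrite !mxE; apply: eq_bigr => r _; rewrite ![_^T _ _]mxE !K'E.
rewrite (hadamard_trmx_mul m_gt0 hadH) scale0r addr0 !mxE /ui.
rewrite !mxtens_indexK (can_eq (@mxtens_indexK m m)) xpair_eqE /=.
by case: (i == k); case: (j == l);
  rewrite ?(mulr0n, mulr1n, mulr0, mulr1, addr0, add0r).
Qed.
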